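(* Let $G$ be a finite connected graph as in the context and fix $\theta\in(0,1)$. The transfer operator $\mathcal T_\theta:=\mathcal T|_{\mathrm{Lip}_\theta}$ is a bounded operator on $(\mathrm{Lip}_\theta,\|\cdot\|_\theta)$. Its spectral radius $\rho=\lim_{n\to\infty}\|\mathcal T_\theta^n\|_{\mathrm{op}}^{1/n}$ does not depend on $\theta$ and satisfies $\rho\le q:=\max_{v\in V}q(v)$, with equality if and only if $G$ is regular (all vertices have the same degree). Furthermore, every $\lambda$ in the spectrum of $\mathcal T_\theta$ with $|\lambda|>\theta\rho$ is an eigenvalue of finite multiplicity, and its eigenspace $\{f\in\mathrm{Lip}_\theta:\mathcal T f=\lambda f\}$ is contained in $D_1$; under the identification of $D_1$ with $\mathrm{Map}(E)$ it equals $\mathrm{Eq}(S,\lambda\,\mathrm{Id})$. If in addition $\lambda\ne\pm1$, this eigenspace is isomorphic (via $d_\lambda$) to $\mathrm{Eq}(\Sigma,R_\lambda)=\mathrm{Eq}(\Delta,L_\lambda)$.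
   Context: $G$ is a connected graph with vertex set $V$, finite, no loops or multiple edges, every vertex of degree $\ge2$; $\deg v=1+q(v)$. $E$ oriented edges, $\iota(e),\tau(e)$ initial/terminal vertex, $\bar e$ opposite edge; turn $e\rightsquigarrow e'$ iff $\tau(e)=\iota(e')$ and $e'\ne\bar e$. $P$ = infinite paths $(e_1,e_2,\dots)$ with $e_i\rightsquigarrow e_{i+1}$. $(\mathcal Tf)(e_1,\dots)=\sum_{e_0\rightsquigarrow e_1}f(e_0,e_1,\dots)$. $D_1$ = functions on $P$ depending only on $e_1$, identified with $\mathrm{Map}(E)$ (all functions $E\to\mathbb C$). $d_\theta(p,p')=\theta^{k-1}$, $k=\min\{i:e_i\ne e'_i\}$; $\mathrm{Lip}_\theta$ = bounded $f$ uniformly $d_\theta$-Lipschitz on each island $\{p:\iota(e_1)=v\}$; $\|f\|_\theta=\mathrm L_1(f)+\|f\|_\infty$, $\mathrm L_1$ = optimal Lipschitz constant over pairs with equal first edge. $\mathrm{Eq}(A,B)=\{f:Af=Bf\}$. $(Sg)(e)=\sum_{e'\rightsquigarrow e}g(e')$; $(\Sigma f)(v)=\sum_{w\text{ adj. }v}f(w)$; $(\Delta f)(v)=\frac1{1+q(v)}\sum_{w\text{ adj. }v}f(w)$; $R_\lambda$ = multiplication by $v\mapsto\lambda+q(v)\lambda^{-1}$; $L_\lambda$ = multiplication by $v\mapsto\frac{\lambda+\lambda^{-1}q(v)}{1+q(v)}$; $d_\lambda f=f\circ\iota-\lambda^{-1}f\circ\tau$. *)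

(* Defs.v *)
From HB Require Import structures.
From mathcomp Require Import all_boot all_order all_algebra.
From mathcomp Require Import all_classical all_reals all_analysis.
From mathcomp Require Import complex.
Set Implicit Arguments. Unset Strict Implicit. Unset Printing Implicit Defensive.
Import Order.TTheory GRing.Theory Num.Theory.
Local Open Scope ring_scope.

Section Graph.
Variable R : realType.
Local Notation C := (R[i]).

Definition cabs (z : C) : R := Normc.normc z.

Variables (V : finType) (adj : rel V).

Definition E := {e : V * V | adj e.1 e.2}.
Definition ini (e : E) : V := (val e).1.
Definition ter (e : E) : V := (val e).2.

(* turn e ~> e' : ter e = ini e' and e' <> opposite of e
   (no multiple edges, so e' = bar e iff ter e' = ini e) *)
Definition turn (e e' : E) : bool := (ter e == ini e') && (ter e' != ini e).

Definition deg (v : V) : nat := #|[set w | adj v w]|.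
Definition qv (v : V) : nat := (deg v).-1.
Definition qmax : nat := \max_(v : V) qv v.
Definition regular : Prop := forall v w : V, deg v = deg w.

(* infinite non-backtracking paths (e_1, e_2, ...), indexed from 0 *)
Definition is_path (p : nat -> E) : Prop := forall n, turn (p n) (p n.+1).
Definition npath := {p : nat -> E | is_path p}.
Definition pe (p : npath) (n : nat) : E := proj1_sig p n.

Definition pcons_fun (e : E) (p : nat -> E) : nat -> E :=
  fun n => if n is n'.+1 then p n' else e.

Lemma pcons_is_path (e : E) (p : npath) :
  turn e (pe p 0) -> is_path (pcons_fun e (proj1_sig p)).
Proof. by move=> h [|n] //=; case: p h => p hp /= h; apply: hp. Qed.

(* prepend the edge e to p (meaningful only if e ~> e_1; otherwise p) *)
Definition pcons (e : E) (p : npath) : npath :=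
  (if turn e (pe p 0) as b return (turn e (pe p 0) = b -> npath)
   then fun h => exist _ (pcons_fun e (proj1_sig p)) (pcons_is_path h)
   else fun _ => p) (erefl _).

Definition Tr (f : npath -> C) : npath -> C :=
  fun p => \sum_(e : E | turn e (pe p 0)) f (pcons e p).

(* the metric d_theta(p,p') = theta^(k-1), k = first (1-based) index of difference *)
Definition dtheta (theta : R) (p p' : npath) : R :=
  match pselect (exists n, pe p n != pe p' n) with
  | left h => theta ^+ (ex_minn h)
  | right _ => 0
  end.

Definition bounded_fun (f : npath -> C) : Prop :=
  exists M : R, forall p, cabs (f p) <= M.

Definition Lip (theta : R) (f : npath -> C) : Prop :=
  bounded_fun f /\
  exists K : R, forall p p' : npath, ini (pe p 0) = ini (pe p' 0) ->
    cabs (f p - f p') <= K * dtheta theta p p'.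

Definition supnorm (f : npath -> C) : R := sup [set cabs (f p) | p in [set: npath]].

Definition L1 (theta : R) (f : npath -> C) : R :=
  sup [set x | exists p p' : npath, pe p 0 = pe p' 0 /\ p <> p' /\
                 x = cabs (f p - f p') / dtheta theta p p'].

Definition lipnorm (theta : R) (f : npath -> C) : R := L1 theta f + supnorm f.

Definition bounded_op (theta : R) (A : (npath -> C) -> (npath -> C)) : Prop :=
  (forall f, Lip theta f -> Lip theta (A f)) /\
  exists M : R, forall f, Lip theta f -> lipnorm theta (A f) <= M * lipnorm theta f.

Definition opnorm (theta : R) (A : (npath -> C) -> (npath -> C)) : R :=
  sup [set lipnorm theta (A f) / lipnorm theta f |
        f in [set f | Lip theta f /\ f <> (fun _ => 0)]].

Definition in_resolvent (theta : R) (lam : C) : Prop :=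
  exists Rinv : (npath -> C) -> (npath -> C),
    bounded_op theta Rinv /\
    (forall f, Lip theta f -> Rinv (fun p => Tr f p - lam * f p) = f) /\
    (forall g, Lip theta g -> (fun p => Tr (Rinv g) p - lam * Rinv g p) = g).
Definition in_spectrum (theta : R) (lam : C) : Prop := ~ in_resolvent theta lam.

Definition Tshift (lam : C) (f : npath -> C) : npath -> C := fun p => Tr f p - lam * f p.

Definition findim (S : set (npath -> C)) : Prop :=
  exists (n : nat) (b : 'I_n -> npath -> C),
    forall f, S f <-> exists c : 'I_n -> C, f = fun p => \sum_(i < n) c i * b i p.

Definition eigspaceT (theta : R) (lam : C) : set (npath -> C) :=
  [set f | Lip theta f /\ Tr f = (fun p => lam * f p)].
Definition geneigspaceT (theta : R) (lam : C) : set (npath -> C) :=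
  [set f | Lip theta f /\ exists k, iter k (Tshift lam) f = (fun _ => 0)].

Definition finite_mult_eigenvalue (theta : R) (lam : C) : Prop :=
  (exists f, eigspaceT theta lam f /\ f <> (fun _ => 0)) /\
  findim (geneigspaceT theta lam).

Definition liftD1 (g : E -> C) : npath -> C := fun p => g (pe p 0).

Definition Sop (g : E -> C) : E -> C := fun e => \sum_(e' : E | turn e' e) g e'.
Definition Sigma (f : V -> C) : V -> C := fun v => \sum_(w : V | adj v w) f w.
Definition Delta (f : V -> C) : V -> C :=
  fun v => (1 + (qv v)%:R)^-1 * \sum_(w : V | adj v w) f w.
Definition Rlam (lam : C) (f : V -> C) : V -> C :=
  fun v => (lam + (qv v)%:R * lam^-1) * f v.
Definition Llam (lam : C) (f : V -> C) : V -> C :=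
  fun v => (lam + lam^-1 * (qv v)%:R) / (1 + (qv v)%:R) * f v.
Definition dlam (lam : C) (f : V -> C) : E -> C :=
  fun e => f (ini e) - lam^-1 * f (ter e).

Definition Eq {T : Type} (A B : (T -> C) -> (T -> C)) : set (T -> C) :=
  [set f | A f = B f].

End Graph.

Arguments Tr {R V} adj f p.
Arguments dtheta {R V} adj theta p p'.
Arguments bounded_fun {R V} adj f.
Arguments Lip {R V} adj theta f.
Arguments supnorm {R V} adj f.
Arguments L1 {R V} adj theta f.
Arguments lipnorm {R V} adj theta f.
Arguments bounded_op {R V} adj theta A.
Arguments opnorm {R V} adj theta A.
Arguments in_resolvent {R V} adj theta lam.
Arguments in_spectrum {R V} adj theta lam.
Arguments Tshift {R V} adj lam f p.
Arguments findim {R V} adj S.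
Arguments eigspaceT {R V} adj theta lam _.
Arguments geneigspaceT {R V} adj theta lam _.
Arguments finite_mult_eigenvalue {R V} adj theta lam.
Arguments liftD1 {R V} adj g p.
Arguments Sop {R V} adj g e.
Arguments Sigma {R V} adj f v.
Arguments Delta {R V} adj f v.
Arguments Rlam {R V} adj lam f v.
Arguments Llam {R V} adj lam f v.
Arguments dlam {R V} adj lam f e.

(* Main.v *)
(* On [Lip_theta / D_1], with norm [L_1], the operator [T^n] has norm at most
   [theta^n a_n], where [a_n] is the largest number of non-backtracking paths of
   [n] edges leading into a given edge; on [Lip_theta] itself its norm is exactly
   [a_n]. So [rho = lim a_n^(1/n)] by Fekete's lemma, and [rho < q] as soon as some
   [a_n < q^n]. If [|lam| > theta rho], the Neumann series inverts [T - lam] modulo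
   [D_1]: generalized eigenfunctions lie in [D_1], and [T - lam] is invertible
   whenever [S - lam] is. *)

(* The obstacle is that the Neumann series need not converge in [Lip]: on $D_1$ the factor
   $\theta^n$ is missing, and $|\lambda|$ may well be at most $\rho$. Convergence modulo $D_1$ is
   made concrete by fixing one path through each edge and subtracting from a partial sum its value
   on the fixed path with the same first edge. What is lost lies in $D_1$, where $T - \lambda$ is
   the finite matrix $S - \lambda$, which either has a kernel or can be inverted. Since the
   resolvent must be bounded, all estimates carry explicit constants. In the equality case, $\rho^n
   \le a_n \le q^n$ turns $\rho = q$ into $a_n = q^n$ for all $n$. As there are finitely many edges,
   one edge attains this for every $n$ at once; this forces maximal branching along all paths
   leading into it, and the difficulty is to carry that forward to the whole graph. *)
Require Import Defs.
From HB Require Import structures.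
From mathcomp Require Import all_boot all_order all_algebra.
From mathcomp Require Import all_classical all_reals all_analysis.
From mathcomp Require Import complex.
From mathcomp Require Import ring lra.
Set Implicit Arguments.
Unset Strict Implicit.
Unset Printing Implicit Defensive.
Import Order.TTheory GRing.Theory Num.Theory.
Import numFieldNormedType.Exports.
Local Open Scope classical_set_scope.
Local Open Scope ring_scope.

(** * The modulus of complex numbers *)

Section ComplexModulus.
Variable R : realType.
Implicit Types z w : R[i].

Lemma cabs_ge0 z : 0 <= cabs z.
Proof. by case: z => a b; rewrite sqrtr_ge0. Qed.

Lemma cabs0 : cabs (0 : R[i]) = 0.
Proof. exact: Normc.normc0. Qed.

Lemma cabs1 : cabs (1 : R[i]) = 1.
Proof. exact: Normc.normc1. Qed.

Lemma cabsM z w : cabs (z * w) = cabs z * cabs w.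
Proof. exact: Normc.normcM. Qed.

Lemma cabsV z : cabs z^-1 = (cabs z)^-1.
Proof. exact: Normc.normcV. Qed.

Lemma cabsX z n : cabs (z ^+ n) = cabs z ^+ n.
Proof. by elim: n => [|n IH]; rewrite ?cabs1 // !exprS cabsM IH. Qed.

Lemma cabsN z : cabs (- z) = cabs z.
Proof. exact: normcN. Qed.

Lemma cabsB z w : cabs (z - w) = cabs (w - z).
Proof. by rewrite -cabsN opprB. Qed.

Lemma cabsD z w : cabs (z + w) <= cabs z + cabs w.
Proof. exact: le_normcD. Qed.

Lemma cabs_dist z u w : cabs (z - w) <= cabs (z - u) + cabs (u - w).
Proof. by rewrite -[z - w](subrKA u) cabsD. Qed.

Lemma cabs_sum (I : finType) (P : pred I) (F : I -> R[i]) :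
  cabs (\sum_(i | P i) F i) <= \sum_(i | P i) cabs (F i).
Proof.
elim/big_ind2: _ => [|z x w y zx wy|//]; first by rewrite cabs0.
exact: le_trans (cabsD _ _) (lerD zx wy).
Qed.

Lemma cabs_eq0 z : cabs z = 0 -> z = 0.
Proof. exact: Normc.eq0_normc. Qed.

Lemma le_Re_cabs z : `|complex.Re z| <= cabs z.
Proof. by case: z => a b /=; rewrite -sqrtr_sqr ler_wsqrtr // lerDl sqr_ge0. Qed.

Lemma le_Im_cabs z : `|complex.Im z| <= cabs z.
Proof. by case: z => a b /=; rewrite -sqrtr_sqr ler_wsqrtr // lerDr sqr_ge0. Qed.

Lemma cabs_le_ReIm z : cabs z <= `|complex.Re z| + `|complex.Im z|.
Proof.
case: z => a b /=; rewrite -[leRHS]ger0_norm ?addr_ge0 // -sqrtr_sqr ler_wsqrtr //.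
by rewrite sqrrD !real_normK ?num_real // lerD2r lerDl mulrn_wge0 // mulr_ge0.
Qed.

Lemma cabs_nat n : cabs (n%:R : R[i]) = n%:R.
Proof. by rewrite /cabs normcMn Normc.normc1. Qed.

Lemma ReB z w : complex.Re (z - w) = complex.Re z - complex.Re w.
Proof. by case: z w => [a b] [c d]. Qed.

Lemma ImB z w : complex.Im (z - w) = complex.Im z - complex.Im w.
Proof. by case: z w => [a b] [c d]. Qed.

End ComplexModulus.

(** * Geometric convergence and growth rates of submultiplicative sequences *)

Section Limits.
Variable R : realType.

(* The intervals [u n - t n, u n + t n], with t n the tail of the geometric
   series, are nested. *)
Lemma geometric_cauchy_real (u : nat -> R) (c r : R) :
    0 <= c -> 0 <= r < 1 -> (forall n, `|u n.+1 - u n| <= c * r ^+ n) ->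
  exists l, forall n, `|l - u n| <= c / (1 - r) * r ^+ n.
Proof.
move=> c0 /andP[r0 r1] hu; set t := fun n => c / (1 - r) * r ^+ n.
have tS n : t n = t n.+1 + c * r ^+ n.
  rewrite /t exprS; field; lra.
have t0 n : 0 <= t n by rewrite /t mulr_ge0 ?exprn_ge0 // divr_ge0 //; lra.
have up n k : u n - t n <= u (k + n)%N - t (k + n)%N.
  elim: k => [//|k IH]; apply: (le_trans IH); rewrite addSn.
  have := hu (k + n)%N; have := tS (k + n)%N; rewrite ler_norml => ? /andP[]; lra.
have dn n k : u (k + n)%N + t (k + n)%N <= u n + t n.
  elim: k => [//|k IH]; apply: le_trans IH; rewrite addSn.
  have := hu (k + n)%N; have := tS (k + n)%N; rewrite ler_norml => ? /andP[]; lra.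
have ub m n : u n - t n <= u m + t m.
  have := up n m; have := dn m n; rewrite addnC.
  by have := t0 (m + n)%N; lra.
pose A := [set u n - t n | n in [set: nat]].
exists (sup A) => n; rewrite ler_distl; apply/andP; split.
  apply: ub_le_sup; last by exists n.
  by exists (u n + t n) => _ [m _ <-].
by apply: ge_sup; [exists (u 0%N - t 0%N), 0%N | move=> _ [m _ <-]].
Qed.

(** Real and imaginary parts converge separately; the factor 2 adds up their two errors. *)
Lemma geometric_cauchy (z : nat -> R[i]) (c r : R) :
    0 <= c -> 0 <= r < 1 -> (forall n, cabs (z n.+1 - z n) <= c * r ^+ n) ->
  exists l, forall n, cabs (l - z n) <= 2 * (c / (1 - r)) * r ^+ n.
Proof.
move=> c0 r01 hz.
have [n|a ha] := @geometric_cauchy_real (fun n => complex.Re (z n)) c r c0 r01.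
  by rewrite -ReB; exact: le_trans (le_Re_cabs _) (hz n).
have [n|b hb] := @geometric_cauchy_real (fun n => complex.Im (z n)) c r c0 r01.
  by rewrite -ImB; exact: le_trans (le_Im_cabs _) (hz n).
exists (a +i* b)%C => n; apply: le_trans (cabs_le_ReIm _) _.
by have := lerD (ha n) (hb n); rewrite ReB ImB /=; lra.
Qed.

(** The way limits are taken below: a quantity independent of [n] is compared with an error that
    decays geometrically in [n]. *)
Lemma geometric_small (c r x : R) :
  0 <= r < 1 -> (forall n, x <= c * r ^+ n) -> x <= 0.
Proof.
move=> /andP[r0 r1] h.
have cv : c * r ^+ n @[n --> \oo] --> (0 : R).
  by rewrite -[0](mulr0 c); apply: cvgMr; apply: cvg_expr; rewrite ger0_norm.
rewrite -(cvg_lim _ cv) //; apply: limr_ge; first exact: cvgP cv.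
by apply: nearW.
Qed.

(* Fekete's lemma in quantitative form. *)
Lemma subadditive_linear (x : nat -> R) :
    (forall n, 0 <= x n) -> (forall m n, x (m + n)%N <= x m + x n) ->
  exists2 L : R, 0 <= L & (forall n, n%:R * L <= x n) /\
    (forall eps, 0 < eps ->
       exists2 C, 0 <= C & forall n, x n <= n%:R * (L + eps) + C).
Proof.
move=> x0 xD; pose A := [set x n.+1 / n.+1%:R | n in [set: nat]].
have A0 : lbound A 0 by move=> _ [n _ <-]; rewrite divr_ge0.
have Ane : A !=set0 by exists (x 1%N / 1%:R), 0%N.
have hA : has_inf A by split=> //; exists 0.
have L0 : 0 <= inf A by exact: lb_le_inf.
exists (inf A) => //; split=> [[|n]|eps e0].
- by rewrite mul0r.
- by rewrite mulrC -ler_pdivlMr //; apply: ge_inf; [exists 0 | exists n].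
have [_ [N _ <-] hN] := inf_adherent e0 hA.
have le0 : 0 <= inf A + eps by lra.
(* Peeling off blocks of length [N.+1] leaves a remainder below [N.+1], and this sum dominates [x]
   at every such remainder. *)
exists (\sum_(r < N.+1) x r); first exact: sumr_ge0.
elim/ltn_ind => n IH; have [nN|nN] := ltnP n N.+1.
  rewrite (bigD1 (Ordinal nN)) //= addrCA lerDl addr_ge0 ?mulr_ge0 //.
  exact: sumr_ge0.
have /IH {}IH : (n - N.+1 < n)%N by rewrite ltn_subrL (leq_trans _ nN).
have hxN : x N.+1 <= N.+1%:R * (inf A + eps).
  by move/ltW: hN; rewrite ler_pdivrMr // mulrC.
have := xD N.+1 (n - N.+1)%N; rewrite subnKC // => /le_trans; apply.
by apply: le_trans (lerD hxN IH) _; rewrite addrA -mulrDl -natrD subnKC.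
Qed.

(** Fekete's lemma for [ln (a n)], nonnegative because [a n] is at least 1; [rho] is [expR] of the
    slope. The two bounds, rather than the limit, are what the spectral estimates use. *)
Lemma submultiplicative_root (a : nat -> R) :
    (forall n, 1 <= a n) -> (forall m n, a (m + n)%N <= a m * a n) ->
  exists2 rho : R, 0 <= rho &
    [/\ a n `^ n%:R^-1 @[n --> \oo] --> rho,
        forall n, rho ^+ n <= a n &
        forall c, rho < c -> exists M, forall n, a n <= M * c ^+ n].
Proof.
move=> a1 aM.
have agt0 n : 0 < a n by exact: lt_le_trans (a1 n).
have aE n : a n = expR (ln (a n)) by rewrite lnK // posrE.
have [n|m n|L L0 [lo hi]] := @subadditive_linear (fun n => ln (a n)).
- by rewrite ln_ge0.
- by rewrite -lnM ?posrE // ler_ln ?posrE ?mulr_gt0.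
exists (expR L); first exact: expR_ge0.
split=> [|n|c cL].
- rewrite (_ : (fun n => _) = expR \o (fun n => n%:R^-1 * ln (a n))); last first.
    by apply/funext => n; rewrite /powR /= gt_eqF.
  apply: continuous_cvg; first exact: continuous_expR.
  apply/cvgrPdist_le => eps e0.
  (* Half of [eps] is slack in the slope; the other half absorbs the constant [C] once [n] reaches
     [C / (eps / 2)]. *)
  have e20 : 0 < eps / 2 by lra.
  have [C C0 hC] := hi _ e20.
  near=> n.
  have n0 : 0 < n%:R :> R by rewrite ltr0n; near: n; exact: nbhs_infty_gt.
  have nC : C / (eps / 2) <= n%:R by near: n; exact: nbhs_infty_ger.
  rewrite distrC ger0_norm; last by rewrite subr_ge0 mulrC ler_pdivlMr // mulrC.
  rewrite lerBlDr mulrC ler_pdivrMr //; apply: (le_trans (hC n)).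
  move: nC; rewrite ler_pdivrMr //; lra.
- by rewrite aE -expRM_natl ler_expR.
- have c0 : 0 < c by apply: lt_trans cL; exact: expR_gt0.
  have e0 : 0 < ln c - L by rewrite subr_gt0 -ltr_expR lnK ?posrE.
  have [C C0 hC] := hi _ e0.
  exists (expR C) => n; rewrite aE -[in c ^+ n](@lnK _ c) ?posrE //.
  rewrite -expRM_natl -expRD ler_expR; apply: (le_trans (hC n)); lra.
Unshelve. all: by end_near.
Qed.

End Limits.

(** * Subspaces and linear systems over a finite index set *)

Section FiniteLinearAlgebra.
Variable F : fieldType.

(** Among the matrices whose row space lies in [P], one of maximal rank exhausts [P]: a vector of
    [P] outside its row space would raise the rank. *)
Lemma rowspace_of_subspace n (P : 'rV[F]_n -> Prop) :
    P 0 -> (forall a v w, P v -> P w -> P (a *: v + w)) ->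
  exists A : 'M[F]_n, forall v, P v <-> (v <= A)%MS.
Proof.
move=> P0 PZD; pose Q r := `[< exists2 A : 'M[F]_n, \rank A = r &
  forall v : 'rV_n, (v <= A)%MS -> P v >].
have Q0 : exists r, Q r.
  by exists 0%N; apply/asboolP; exists 0 => [|v]; rewrite ?mxrank0 // submx0 => /eqP->.
have Qn r : Q r -> (r <= n)%N by move/asboolP => [A <- _]; exact: rank_leq_row.
case: (ex_maxnP Q0 Qn) => r /asboolP[A rA AP] rmax.
exists A => v; split=> [Pv|/AP //]; apply: contraT => vA.
have /rmax : Q (\rank (A + v)%MS).
  apply/asboolP; exists (A + v)%MS => // w /sub_addsmxP[[u1 u2] /= ->].
  rewrite addrC; have -> : u2 *m v = u2 0 0 *: v.
    by rewrite [u2]mx11_scalar mul_scalar_mx mxE eqxx.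
  by apply: PZD => //; apply: AP; exact: submxMl.
rewrite -rA => le; have := mxrank_leqif_sup (addsmxSl A v) => /leqifP.
by case: ifP => [/(submx_trans (addsmxSr A v))|_]; rewrite ?(negPf vA) // ltnNge le.
Qed.

Variable I : finType.
Let row_of (g : I -> F) : 'rV[F]_#|I| := \row_j g (enum_val j).
Let fun_of (v : 'rV[F]_#|I|) : I -> F := fun i => v 0 (enum_rank i).

Let row_ofK g : fun_of (row_of g) = g.
Proof. by apply/funext => i; rewrite /fun_of mxE enum_rankK. Qed.

Let fun_ofK v : row_of (fun_of v) = v.
Proof. by apply/rowP => j; rewrite mxE /fun_of enum_valK. Qed.

Lemma subspace_spanning_family (P : (I -> F) -> Prop) :
    P (fun=> 0) -> (forall a g h, P g -> P h -> P (fun i => a * g i + h i)) ->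
  exists n (b : 'I_n -> I -> F), forall g,
    P g <-> exists c : 'I_n -> F, g = fun i => \sum_(j < n) c j * b j i.
Proof.
move=> P0 PZD.
have [||A hA] := @rowspace_of_subspace _ (P \o fun_of).
- by rewrite /= (_ : fun_of 0 = fun=> 0) //; apply/funext => i; rewrite /fun_of mxE.
- move=> a v w /= Pv Pw; rewrite (_ : fun_of _ = fun i => a * fun_of v i + fun_of w i).
    exact: PZD.
  by apply/funext => i; rewrite /fun_of !mxE.
exists #|I|, (fun j => fun_of (row j A)) => g; rewrite -[in P g](row_ofK g).
have -> : P (fun_of (row_of g)) <-> (row_of g <= A)%MS by exact: hA.
split=> [/submxP[u gu]|[c gc]].
  exists (fun j => u 0 j); rewrite -[LHS]row_ofK gu; apply/funext => i.
  by rewrite /fun_of mxE; apply: eq_bigr => j _; rewrite !mxE.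
apply/submxP; exists (\row_j c j); apply/rowP => j; rewrite !mxE gc.
by apply: eq_bigr => k _; rewrite /fun_of !mxE enum_valK.
Qed.

Lemma finite_alternative (K : I -> I -> F) :
  (exists2 g : I -> F, g <> (fun=> 0) & forall i, \sum_j K i j * g j = 0) \/
  (exists L : I -> I -> F, forall g i, \sum_j K i j * (\sum_k L j k * g k) = g i).
Proof.
(* Functions are encoded as row vectors, so the kernel enters transposed: right multiplication by
   [A] is then the action of [K]. *)
pose A : 'M[F]_#|I| := \matrix_(i, j) K (enum_val j) (enum_val i).
have mulA v i : (v *m A) 0 (enum_rank i) = \sum_j K i j * fun_of v j.
  rewrite mxE [RHS](reindex _ (onW_bij _ (enum_val_bij I))) /=.
  by apply: eq_bigr => j _; rewrite mxE enum_rankK mulrC /fun_of enum_valK.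
have [uA|nuA] := boolP (A \in unitmx); [right|left].
  exists (fun j k => invmx A (enum_rank k) (enum_rank j)) => g i.
  rewrite -[RHS](congr1 (fun h => h i) (row_ofK g)) /fun_of -[row_of g](mulmxKV uA) mulA.
  apply: eq_bigr => j _; congr (_ * _); rewrite /fun_of mxE.
  rewrite (reindex _ (onW_bij _ (enum_val_bij I))) /=.
  by apply: eq_bigr => k _; rewrite mxE enum_valK mulrC.
move: nuA; rewrite unitmxE unitfE negbK => /det0P[v v0 vA].
exists (fun_of v) => [g0|i]; last by rewrite -mulA vA mxE.
by case/eqP: v0; rewrite -[LHS]fun_ofK g0; apply/rowP => j; rewrite !mxE.
Qed.

End FiniteLinearAlgebra.

(** * Lipschitz functions on path space and iterates of the transfer operator *)

Section PathSpace.
Variables (R : realType) (V : finType) (adj : rel V).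
Implicit Types (e : E adj) (p : npath adj) (f g : npath adj -> R[i]).

Lemma npath_eq p p' : (forall n, pe p n = pe p' n) -> p = p'.
Proof.
case: p p' => [p hp] [p' hp'] /= /funext epp'; rewrite /pe /= in epp'.
by subst p'; rewrite (Prop_irrelevance hp hp').
Qed.

Lemma pe_pcons e p : turn e (pe p 0) -> pe (pcons e p) =1 pcons_fun e (pe p).
Proof.
rewrite /pcons => ep n.
(* The definition matches on a boolean together with its equation; both are generalised so that the
   case split is well typed. *)
suff: forall b (eb : turn e (pe p 0) = b), b ->
  pe ((if b as b return (turn e (pe p 0) = b -> npath adj)
   then fun ept => exist _ (pcons_fun e (proj1_sig p)) (pcons_is_path ept)
   else fun _ => p) eb) n = pcons_fun e (pe p) n by apply.
by case.
Qed.

Lemma pe_pcons0 e p : turn e (pe p 0) -> pe (pcons e p) 0 = e.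
Proof. by move=> /pe_pcons ->. Qed.

Variable theta : R.
Hypothesis theta01 : 0 < theta < 1.

Let theta_gt0 : 0 < theta. Proof. by case/andP: theta01. Qed.
Let theta_lt1 : theta < 1. Proof. by case/andP: theta01. Qed.

Variant dtheta_spec p p' : R -> Prop :=
  | DthetaEq of p = p' : dtheta_spec p p' 0
  | DthetaNeq n of pe p n != pe p' n & (forall m, (m < n)%N -> pe p m = pe p' m) :
      dtheta_spec p p' (theta ^+ n).

Lemma dthetaP p p' : dtheta_spec p p' (dtheta adj theta p p').
Proof.
rewrite /dtheta; case: pselect => [ex|nex].
  case: ex_minnP => n hn min; constructor => // m mn.
  by apply/eqP; apply: contraTT mn => /min; rewrite -leqNgt.
constructor; apply: npath_eq => n; apply/eqP.
by apply: contra_notT nex => ?; exists n.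
Qed.

Lemma dtheta_ge0 p p' : 0 <= dtheta adj theta p p'.
Proof. by case: dthetaP => // n _ _; rewrite exprn_ge0 // ltW. Qed.

Lemma dtheta_le1 p p' : dtheta adj theta p p' <= 1.
Proof. by case: dthetaP => // n _ _; rewrite exprn_ile1 // ltW. Qed.

Lemma dtheta_gt0 p p' : p <> p' -> 0 < dtheta adj theta p p'.
Proof. by case: dthetaP => // n _ _ _; rewrite exprn_gt0. Qed.

Lemma dtheta_neq0 p p' : pe p 0 <> pe p' 0 -> dtheta adj theta p p' = 1.
Proof.
case: dthetaP => [->//|[|n] _ lt] // p0.
by case: p0; apply: lt.
Qed.

(** The source of every factor [theta]: a common new first edge delays the first difference by one
    index. *)
Lemma dtheta_pcons e p p' : turn e (pe p 0) -> turn e (pe p' 0) ->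
  dtheta adj theta (pcons e p) (pcons e p') = theta * dtheta adj theta p p'.
Proof.
move=> ep ep'; case: (dthetaP p p') => [->|n nE ltE].
  by case: dthetaP => [|n /eqP//]; rewrite mulr0.
rewrite -exprS; case: dthetaP => [eqc|m].
  have := congr1 (fun q => pe q n.+1) eqc; rewrite /= !pe_pcons //= => eqn.
  by rewrite eqn eqxx in nE.
rewrite (pe_pcons ep) (pe_pcons ep'); case: m => [/eqP//|m mE ltm].
have mn : (m <= n)%N.
  rewrite leqNgt; apply/negP => lt; move/eqP: nE; apply.
  by have := ltm n.+1 lt; rewrite (pe_pcons ep) (pe_pcons ep').
have nm : (n <= m)%N.
  by rewrite leqNgt; apply/negP => lt; move/eqP: mE; apply; exact: ltE.
by have -> : m = n by apply/eqP; rewrite eqn_leq mn.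
Qed.

(** Explicit constants, [A] for the seminorm $L_1$ and [B] for the sup norm. Only pairs with equal
    first edge are compared, as in $L_1$, whereas [Lip] compares pairs with equal initial vertex. *)
Definition lip_bound (A B : R) f :=
  (forall p, cabs (f p) <= B) /\
  (forall p p', pe p 0 = pe p' 0 -> cabs (f p - f p') <= A * dtheta adj theta p p').

Lemma lip_bound_Lip A B f : 0 <= A -> lip_bound A B f -> Lip adj theta f.
Proof.
move=> A0 [fB fA]; split; first by exists B.
(* Paths with different first edges are at distance 1, so [2 * B] takes care of them. *)
exists (A + 2 * B) => p p' _; have B0 := le_trans (cabs_ge0 _) (fB p).
have [p0|p0] := eqVneq (pe p 0) (pe p' 0).
  apply: le_trans (fA _ _ p0) _; rewrite ler_wpM2r ?dtheta_ge0 //; lra.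
rewrite dtheta_neq0; last exact/eqP.
apply: le_trans (cabsD _ _) _; rewrite cabsN; have := fB p; have := fB p'; lra.
Qed.

Lemma Lip_lip_bound f : Lip adj theta f ->
  exists2 A, 0 <= A & exists B, lip_bound A B f.
Proof.
case=> [[B fB] [K fK]]; exists `|K| => //; exists B; split=> // p p' p0.
apply: (le_trans (fK p p' _)); first by rewrite p0.
by rewrite ler_wpM2r ?dtheta_ge0 ?ler_norm.
Qed.

Lemma lip_boundZD a A B A' B' f g : lip_bound A B f -> lip_bound A' B' g ->
  lip_bound (cabs a * A + A') (cabs a * B + B') (fun p => a * f p + g p).
Proof.
move=> [fB fA] [gB gA]; split=> [p|p p' p0].
  apply: le_trans (cabsD _ _) (lerD _ (gB p)).
  by rewrite cabsM ler_wpM2l ?cabs_ge0.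
rewrite opprD addrACA -mulrBr mulrDl -mulrA.
apply: le_trans (cabsD _ _) (lerD _ (gA _ _ p0)).
by rewrite cabsM ler_wpM2l ?cabs_ge0 ?fA.
Qed.

Lemma LipZD a f g : Lip adj theta f -> Lip adj theta g ->
  Lip adj theta (fun p => a * f p + g p).
Proof.
move=> /Lip_lip_bound[A A0 [B fAB]] /Lip_lip_bound[A' A'0 [B' gAB]].
apply: lip_bound_Lip (lip_boundZD a fAB gAB).
by rewrite addr_ge0 // mulr_ge0 // cabs_ge0.
Qed.

Lemma lip_bound_liftD1 (k : E adj -> R[i]) B :
  (forall e, cabs (k e) <= B) -> lip_bound 0 B (liftD1 adj k).
Proof.
move=> kB; split=> [p|p p' p0]; first exact: kB.
by rewrite /liftD1 p0 subrr cabs0 mul0r.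
Qed.

Lemma Lip_liftD1 (k : E adj -> R[i]) : Lip adj theta (liftD1 adj k).
Proof.
apply: (@lip_bound_Lip 0 (\sum_e cabs (k e))) => //; apply: lip_bound_liftD1 => e.
by rewrite (bigD1 e) //= lerDl sumr_ge0 // => *; apply: cabs_ge0.
Qed.

Lemma TrZD a f g p : Tr adj (fun p => a * f p + g p) p = a * Tr adj f p + Tr adj g p.
Proof. by rewrite /Tr mulr_sumr -big_split. Qed.

Lemma Tr_liftD1 (k : E adj -> R[i]) : Tr adj (liftD1 adj k) = liftD1 adj (Sop adj k).
Proof.
apply/funext => p; apply: eq_bigr => e ep; by rewrite /liftD1 pe_pcons0.
Qed.

(* The number of non-backtracking paths of [n] edges that can be continued by [e]. *)
Fixpoint nback n e : nat := if n is m.+1 then \sum_(e' | turn e' e) nback m e' else 1.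

(** The number $a_n$ of the overview. *)
Definition nbmax n : nat := \max_e nback n e.

Lemma leq_nbmax n e : (nback n e <= nbmax n)%N.
Proof. exact: leq_bigmax. Qed.

Lemma ler_nbmax n e : (nback n e)%:R <= (nbmax n)%:R :> R.
Proof. by rewrite ler_nat leq_nbmax. Qed.

(** A path of [m + n] edges is cut before its last [n] edges. *)
Lemma nback_submul m n e : (nback (m + n) e <= nbmax m * nback n e)%N.
Proof.
elim: n e => [|n IH] e; first by rewrite addn0 muln1 leq_nbmax.
by rewrite addnS /= big_distrr leq_sum.
Qed.

Lemma nbmax_submul m n : (nbmax (m + n) <= nbmax m * nbmax n)%N.
Proof.
by apply/bigmax_leqP => e _; rewrite (leq_trans (nback_submul _ _ _)) // leq_mul ?leq_nbmax.
Qed.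

Lemma iter_Tr_sup B f n p : (forall p, cabs (f p) <= B) ->
  cabs (iter n (Tr adj) f p) <= (nback n (pe p 0))%:R * B.
Proof.
move=> fB; elim: n p => [|n IH] p; first by rewrite mul1r.
apply: le_trans (cabs_sum _ _) _; rewrite natr_sum mulr_suml.
by apply: ler_sum => e ep; rewrite (le_trans (IH _)) // pe_pcons0.
Qed.

(** Paths with the same first edge admit the same prefixes, so the two sums are compared term by
    term; prepending [n] common edges shrinks each distance by $\theta^n$. *)
Lemma iter_Tr_diff A B f n p p' : lip_bound A B f -> pe p 0 = pe p' 0 ->
  cabs (iter n (Tr adj) f p - iter n (Tr adj) f p') <=
    theta ^+ n * (nback n (pe p 0))%:R * (A * dtheta adj theta p p').
Proof.
case=> _ fA; elim: n p p' => [|n IH] p p' p0; first by rewrite !mul1r fA.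
rewrite /= /Tr -p0 -sumrB natr_sum; apply: le_trans (cabs_sum _ _) _.
rewrite mulr_sumr mulr_suml; apply: ler_sum => e ep.
have ep' : turn e (pe p' 0) by rewrite -p0.
have := IH (pcons e p) (pcons e p'); rewrite !pe_pcons0 // dtheta_pcons //.
by move/(_ erefl)/le_trans; apply; rewrite exprS le_eqVlt; apply/orP; left; apply/eqP; ring.
Qed.

Lemma lip_bound_iter_Tr A B f n : 0 <= A -> lip_bound A B f ->
  lip_bound (theta ^+ n * (nbmax n)%:R * A) ((nbmax n)%:R * B) (iter n (Tr adj) f).
Proof.
move=> A0 fAB; split=> [p|p p' p0].
  have [fB _] := fAB; apply: le_trans (iter_Tr_sup n p fB) _.
  by rewrite ler_wpM2r ?ler_nbmax // (le_trans _ (fB p)) ?cabs_ge0.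
apply: le_trans (iter_Tr_diff n fAB p0) _.
rewrite mulrA ler_wpM2r ?dtheta_ge0 // ler_wpM2r //.
by rewrite ler_wpM2l ?ler_nbmax // exprn_ge0 // ltW.
Qed.

Lemma Lip_iter_Tr n f : Lip adj theta f -> Lip adj theta (iter n (Tr adj) f).
Proof.
case/Lip_lip_bound => A A0 [B fAB]; apply: lip_bound_Lip (lip_bound_iter_Tr n A0 fAB).
by rewrite !mulr_ge0 // exprn_ge0 // ltW.
Qed.

Lemma L1_ge0 f : 0 <= L1 adj theta f.
Proof.
rewrite /L1; set A := [set _ | _]; have [hA|] := pselect (has_sup A); last first.
  (* A set without supremum has [sup] equal to 0. *)
  by move/sup_out->.
case: (hA) => [[x Ax] _]; apply: le_trans (ub_le_sup hA.2 Ax).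
by case: Ax => p [p' [_ [_ ->]]]; rewrite divr_ge0 ?cabs_ge0 ?dtheta_ge0.
Qed.

Lemma L1_le A B f : 0 <= A -> lip_bound A B f -> L1 adj theta f <= A.
Proof.
move=> A0 [_ fA]; rewrite /L1; set X := [set _ | _].
have [->|/set0P X0] := eqVneq X set0; first by rewrite sup0.
apply: ge_sup => // _ [p [p' [p0 [pp' ->]]]].
by rewrite ler_pdivrMr ?dtheta_gt0 // fA.
Qed.

Lemma le_supnorm A B f p : lip_bound A B f -> cabs (f p) <= supnorm adj f.
Proof. by case=> fB _; apply: ub_le_sup; [exists B => _ [q _ <-]|exists p]. Qed.

Lemma lip_bound_norm f : Lip adj theta f ->
  lip_bound (L1 adj theta f) (supnorm adj f) f.
Proof.
case/Lip_lip_bound => A A0 [B fAB]; split=> [p|p p' p0]; first exact: le_supnorm fAB.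
have [->|pp'] := pselect (p = p'); first by rewrite subrr cabs0 mulr_ge0 ?L1_ge0 ?dtheta_ge0.
rewrite -ler_pdivrMr ?dtheta_gt0 //; apply: ub_le_sup; last by exists p, p'.
exists A => _ [q [q' [q0 [qq' ->]]]].
by rewrite ler_pdivrMr ?dtheta_gt0 //; case: fAB => _; apply.
Qed.

End PathSpace.

(** * Counting non-backtracking paths *)

Section NonBacktracking.
Variables (V : finType) (adj : rel V).
Hypothesis Hsym : symmetric adj.
Hypothesis Hdeg : forall v, (2 <= deg adj v)%N.
Implicit Types (u v w : V) (e : E adj).

Lemma adj_edge e : adj (ini e) (ter e).
Proof. exact: valP e. Qed.

Lemma edge_exists u v : adj u v -> exists2 e : E adj, ini e = u & ter e = v.
Proof. by move=> uv; exists (exist _ (u, v) uv). Qed.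

Lemma edge_eq e e' : ini e = ini e' -> ter e = ter e' -> e = e'.
Proof.
move=> ei et; apply: val_inj; move: ei et; rewrite /ini /ter.
by case: (val e) (val e') => a b [c d] /= -> ->.
Qed.

Definition edge_rev e : E adj :=
  exist _ (ter e, ini e) (etrans (Hsym (ter e) (ini e)) (adj_edge e)).

Lemma edge_revK : involutive edge_rev.
Proof. by move=> e; apply: edge_eq. Qed.

Lemma turn_rev e e' : turn (edge_rev e) (edge_rev e') = turn e' e.
Proof. by rewrite /turn /ini /ter /= eq_sym [X in _ && ~~ X]eq_sym. Qed.

(** An edge into [ini e] is determined by its origin [u], and the turn excludes exactly
    [u = ter e]. *)
Lemma sum_turn (M : nmodType) (F : V -> V -> M) e :
  \sum_(e' : E adj | turn e' e) F (ini e') (ter e') =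
  \sum_(u | adj (ini e) u && (u != ter e)) F u (ini e).
Proof.
have turnE e' : turn e' e = (ter e' == ini e) && (ini e' != ter e).
  by rewrite /turn [ter e == _]eq_sym.
rewrite (eq_bigl _ _ turnE).
rewrite -(big_sub_cond (fun x => adj x.1 x.2)
  (fun x : V * V => (x.2 == ini e) && (x.1 != ter e)) (fun x => F x.1 x.2)).
rewrite (reindex_onto (fun u => (u, ini e)) fst) => [|[u v]] /=; last first.
  by case/and3P => _ /eqP /= ->.
by apply: eq_bigl => u; rewrite !eqxx andbT /= unfold_in /= Hsym.
Qed.

Lemma deg_qv v : deg adj v = (qv adj v).+1.
Proof. by rewrite /qv prednK // (leq_trans _ (Hdeg v)). Qed.

Lemma qv_gt0 v : (0 < qv adj v)%N.
Proof. by rewrite -ltnS -deg_qv. Qed.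

Lemma card_adj_neq u v : adj v u -> #|[set w | adj v w && (w != u)]%SET| = qv adj v.
Proof.
move=> vu; rewrite /qv /deg (cardsD1 u [set w | adj v w]%SET) inE vu add1n /=.
by congr #|pred_of_set _|; apply/setP => w; rewrite !inE andbC.
Qed.

Lemma adj_neq_exists u v : adj v u -> exists2 w, adj v w & w != u.
Proof.
move=> vu; have : (0 < #|[set w | adj v w && (w != u)]%SET|)%N.
  by rewrite card_adj_neq ?qv_gt0.
by case/card_gt0P => w; rewrite inE => /andP[]; exists w.
Qed.

Lemma edge_from v : exists e : E adj, ini e = v.
Proof.
have : (0 < deg adj v)%N by rewrite deg_qv.
by case/card_gt0P => w; rewrite inE => /edge_exists[e <-]; exists e.
Qed.

(** Degrees are at least 2, so every edge has a successor; iterating a choice of successor gives the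
    path. This transfers identities between functions in $D_1$ to their values on edges. *)
Lemma path_from e : exists p : npath adj, pe p 0 = e.
Proof.
have next e1 : exists e2, turn e1 e2.
  have [w vw wu] : exists2 w, adj (ter e1) w & w != ini e1.
    by apply: adj_neq_exists; rewrite Hsym adj_edge.
  by have [e2 i2 t2] := edge_exists vw; exists e2; rewrite /turn i2 t2 eqxx.
have [s hs] := choice next.
have pth : is_path (fun n => iter n s e) by move=> n; exact: hs.
by exists (exist _ _ pth).
Qed.

Lemma sum_turn1 e : (\sum_(e' : E adj | turn e' e) 1)%N = qv adj (ini e).
Proof.
rewrite (sum_turn (fun _ _ => 1%N) e) sum1dep_card.
by rewrite card_adj_neq ?adj_edge.
Qed.

(** Reversing edges exchanges successors and predecessors. *)
Lemma sum_turnr1 e : (\sum_(e' : E adj | turn e e') 1)%N = qv adj (ter e).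
Proof.
rewrite (reindex_inj (inv_inj edge_revK)) -[RHS](sum_turn1 (edge_rev e)).
by apply: eq_bigl => e'; rewrite -{1}[e]edge_revK turn_rev.
Qed.

Lemma nback1 e : nback 1 e = qv adj (ini e).
Proof. exact: sum_turn1. Qed.

Lemma nback_gt0 n e : (0 < nback n e)%N.
Proof.
elim: n e => //= n IH e; apply: (@leq_trans (\sum_(e' | turn e' e) 1)%N).
  by rewrite sum_turn1 qv_gt0.
by apply: leq_sum => e' _; apply: IH.
Qed.

Lemma nbmax1 : nbmax adj 1 = qmax adj.
Proof.
apply/eqP; rewrite eqn_leq; apply/andP; split; apply/bigmax_leqP.
  by move=> e _; rewrite nback1; exact: (leq_bigmax (ini e)).
move=> v _.
by have [e <-] := edge_from v; rewrite -nback1 leq_nbmax.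
Qed.

Lemma nback_le n e : (nback n e <= qmax adj ^ n)%N.
Proof.
elim: n e => [//|n IH] e; rewrite -addn1 (leq_trans (nback_submul _ _ _)) //.
rewrite addn1 expnSr leq_mul //; first by apply/bigmax_leqP => e' _; apply: IH.
by rewrite -nbmax1 leq_nbmax.
Qed.

Lemma nbmax_le n : (nbmax adj n <= qmax adj ^ n)%N.
Proof. by apply/bigmax_leqP => e _; apply: nback_le. Qed.

Lemma qv_le v : (qv adj v <= qmax adj)%N.
Proof. exact: leq_bigmax. Qed.

Hypothesis Hne : (0 < #|V|)%N.

Lemma edge_inhabited : exists e : E adj, true.
Proof. by case/card_gt0P: Hne => v _; have [e _] := edge_from v; exists e. Qed.

Lemma nbmax_eq n : exists e, nback n e = nbmax adj n.
Proof.
have [e0 _] := edge_inhabited.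
have : (0 < #|{: E adj}|)%N by apply/card_gt0P; exists e0.
by case/(bigop.eq_bigmax (@nback _ adj n)) => e eE; exists e; exact: esym.
Qed.

Lemma nbmax_gt0 n : (0 < nbmax adj n)%N.
Proof. by have [e <-] := nbmax_eq n; apply: nback_gt0. Qed.

Lemma qmax_gt0 : (0 < qmax adj)%N.
Proof. by rewrite -nbmax1 nbmax_gt0. Qed.

Lemma nbmax_regular n : regular adj -> nbmax adj n = (qmax adj ^ n)%N.
Proof.
move=> reg; have qE v : qv adj v = qmax adj.
  apply/eqP; rewrite eqn_leq qv_le; apply/bigmax_leqP => w _.
  by rewrite /qv (reg w v).
suff nE m e : nback m e = (qmax adj ^ m)%N.
  by have [e <-] := nbmax_eq n; apply: nE.
elim: m e => // m IH e; rewrite /= (eq_bigr _ (fun e' _ => IH e')) expnS.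
by rewrite -[X in (X * _)%N](qE (ini e)) -sum_turn1 big_distrl /=; apply: eq_bigr => *; rewrite mul1n.
Qed.

(** * Maximal growth forces regularity *)

Hypothesis Hconn : forall u v, connect adj u v.

(* The edges all of whose backward histories branch maximally. Counting turns
   shows that this set is closed under successors as well as predecessors. *)
Let full e := `[< forall n, nback n e = (qmax adj ^ n)%N >].

(** Otherwise each edge [e] falls short of the maximum at some length [k e]. The deficit persists at
    all greater lengths by submultiplicativity, so at the length [N], the largest [k e], no edge
    reaches $q^N$. *)
Let full_exists : (forall n, nbmax adj n = qmax adj ^ n)%N -> exists e, full e.
Proof.
move=> hmax; apply: contrapT => /forallNP nfull.
have small e : exists n, (nback n e < qmax adj ^ n)%N.
  apply: contrapT => /forallNP nn; apply: (nfull e); apply/asboolP => n.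
  by apply/eqP; rewrite eqn_leq nback_le leqNgt; apply/negP.
have [k hk] := choice small.
pose N := \max_e k e; have [e eN] := nbmax_eq N.
have kN : (k e <= N)%N by exact: leq_bigmax.
have := nback_submul (N - k e) (k e) e; rewrite subnK // eN hmax leqNgt => /negP; apply.
apply: (@leq_ltn_trans (qmax adj ^ (N - k e) * nback (k e) e)%N).
  by rewrite leq_mul2r nbmax_le orbT.
by rewrite -[in ltnRHS](subnK kN) expnD ltn_pmul2l ?expn_gt0 ?qmax_gt0.
Qed.

Let full_qv e : full e -> qv adj (ini e) = qmax adj.
Proof. by move/asboolP/(_ 1%N); rewrite nback1 expn1. Qed.

(** The count for [e] is a sum over $q$ predecessors of terms at most $q^n$; equality of the sums
    forces equality in each term. *)
Let full_pred e e' : turn e' e -> full e -> full e'.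
Proof.
move=> ee' fe; apply/asboolP => n; have /asboolP/(_ n.+1)/= := fe.
have -> : (qmax adj ^ n.+1 = \sum_(e1 | turn e1 e) qmax adj ^ n)%N.
  rewrite expnS -[X in (X * _)%N](full_qv fe) -sum_turn1 big_distrl /=.
  by apply: eq_bigr => *; rewrite mul1n.
have := @leqif_sum _ (fun e1 => turn e1 e) (fun e1 => nback n e1 == qmax adj ^ n)%N
  (@nback _ adj n) (fun=> qmax adj ^ n)%N (fun e1 _ => leqif_eq (nback_le n e1)).
by case=> _ h eqs; move: h; rewrite eqs eqxx => /esym/forall_inP/(_ e' ee')/eqP.
Qed.

(** Turns between full edges are counted twice. By target there are exactly $q$ per full edge, as
    all predecessors are full; by source there are at most $q$. The totals agree, so every source
    attains $q$. *)
Let full_turn_count e : full e ->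
  (\sum_(e' | full e' && turn e e') 1 = qmax adj)%N.
Proof.
have le_count e1 : (\sum_(e' | full e' && turn e1 e') 1 <= qmax adj)%N.
  apply: leq_trans (qv_le (ter e1)); rewrite -sum_turnr1 [leqRHS](bigID full) /=.
  by rewrite (eq_bigl _ _ (fun e' => andbC _ _)) leq_addr.
have := @leqif_sum _ full (fun e1 => \sum_(e' | full e' && turn e1 e') 1 == qmax adj)%N
  (fun e1 => \sum_(e' | full e' && turn e1 e') 1)%N (fun=> qmax adj)
  (fun e1 _ => leqif_eq (le_count e1)).
suff -> : (\sum_(e1 | full e1) \sum_(e' | full e' && turn e1 e') 1 =
           \sum_(e1 | full e1) qmax adj)%N.
  by case=> _; rewrite eqxx => /esym/forall_inP h /h/eqP.
rewrite (exchange_big_dep full) /=; last by move=> ? ? _ /andP[].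
apply: eq_bigr => e1 fe1; rewrite -(full_qv fe1) -sum_turn1.
by apply: eq_bigl => e2; rewrite fe1 andb_idl // => /full_pred; apply.
Qed.

(** There are at most $q$ successors in all, and $q$ of them are already full. *)
Let full_succ e e' : turn e e' -> full e -> full e'.
Proof.
move=> ee' fe; apply: contraT => nf.
have := qv_le (ter e); rewrite -sum_turnr1 (bigID full) /=.
rewrite (eq_bigl _ _ (fun e' => andbC _ _)) (full_turn_count fe).
by rewrite (bigD1 e') ?ee' //= leqNgt add1n -addSnnS addSn ltnS leq_addr.
Qed.

Lemma nbmax_eq_regular : (forall n, nbmax adj n = qmax adj ^ n)%N -> regular adj.
Proof.
move=> hmax; have [q1|q1] := leqP (qmax adj) 1.
  have deg2 v : deg adj v = 2%N.
    by apply/eqP; rewrite eqn_leq Hdeg deg_qv ltnS (leq_trans (qv_le v)).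
  by move=> v w; rewrite !deg2.
have [e fe] := full_exists hmax.
(* Fullness alone does not pass from an edge to its reverse by a turn; once all edges leaving a
   vertex are known to be full, connectivity spreads the property. *)
pose W v := forall e' : E adj, ini e' = v -> full e'.
have W_ter e1 : full e1 -> W (ter e1).
  move=> fe1 e' ie'; have [te'|te'] := eqVneq (ter e') (ini e1); last first.
    by apply: full_succ fe1; rewrite /turn ie' eqxx te'.
  have qve : qv adj (ter e1) = qmax adj.
    have [w vw wu] : exists2 w, adj (ter e1) w & w != ini e1.
      by apply: adj_neq_exists; rewrite Hsym adj_edge.
    have [e2 i2 t2] := edge_exists vw.
    by rewrite -i2; apply/full_qv/(full_succ _ fe1); rewrite /turn i2 t2 eqxx.
  have vu : adj (ter e1) (ini e1) by rewrite Hsym adj_edge.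
  move: q1; rewrite -qve -(card_adj_neq vu) => /card_gt1P[w1 [w2 []]].
  rewrite !inE => /andP[vw1 w1u] /andP[vw2 w2u] w12.
  (* Here [e'] reverses [e1], so it is reached by a detour: [e2], towards [w1], succeeds [e1]; [e3],
     coming from [w2], precedes [e2]; and [e'] succeeds [e3]. Two further neighbours exist because
     $q > 1$. *)
  have [e2 i2 t2] := edge_exists vw1.
  have f2 : full e2 by apply: full_succ fe1; rewrite /turn i2 t2 eqxx.
  have [e3 i3 t3] : exists2 e3 : E adj, ini e3 = w2 & ter e3 = ter e1.
    by apply: edge_exists; rewrite Hsym.
  have f3 : full e3 by apply: full_pred f2; rewrite /turn t3 i2 eqxx t2 i3.
  by apply: full_succ f3; rewrite /turn t3 ie' eqxx te' i3 eq_sym.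
have W_adj v w : adj v w -> W v -> W w.
  by case/edge_exists => e1 <- <- We; apply/W_ter/We.
have W_all v : W v.
  have [s pth ->] := connectP (Hconn (ter e) v).
  elim: s (ter e) (W_ter e fe) pth => [//|w s IH] u Wu /= /andP[uw].
  exact/IH/(W_adj u).
have qE v : qv adj v = qmax adj.
  by have [e1 ie1] := edge_from v; rewrite -ie1; apply/full_qv/(W_all v).
by move=> v w; rewrite !deg_qv !qE.
Qed.

End NonBacktracking.

(** * Operator norms of the iterates, and the spectrum outside the disc of radius $\theta\rho$ *)

Section Spectrum.
Variables (R : realType) (V : finType) (adj : rel V).
Hypothesis Hsym : symmetric adj.
Hypothesis Hdeg : forall v, (2 <= deg adj v)%N.
Hypothesis Hne : (0 < #|V|)%N.
Variable theta : R.
Hypothesis theta01 : 0 < theta < 1.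
Implicit Types (e : E adj) (p : npath adj) (f g h : npath adj -> R[i]) (k : E adj -> R[i]).

Let theta_ge0 : 0 <= theta. Proof. by case/andP: theta01 => /ltW. Qed.
Let theta_le1 : theta <= 1. Proof. by case/andP: theta01 => _ /ltW. Qed.

Lemma npath_inhabited : exists p : npath adj, true.
Proof.
have [e _] := edge_inhabited Hdeg Hne.
by have [p _] := path_from Hsym Hdeg e; exists p.
Qed.

Lemma supnorm_le B f : (forall p, cabs (f p) <= B) -> supnorm adj f <= B.
Proof.
move=> fB; have [p0 _] := npath_inhabited.
by apply: ge_sup => [|_ [p _ <-]//]; exists (cabs (f p0)), p0.
Qed.

Lemma supnorm_ge0 f : Lip adj theta f -> 0 <= supnorm adj f.
Proof.
move=> /(lip_bound_norm theta01)[fB _]; have [p _] := npath_inhabited.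
exact: le_trans (cabs_ge0 _) (fB p).
Qed.

Lemma lipnorm_le A B f : 0 <= A -> lip_bound theta A B f -> lipnorm adj theta f <= A + B.
Proof.
move=> A0 fAB; rewrite lerD // ?(L1_le theta01 A0 fAB) // supnorm_le //.
by case: fAB.
Qed.

Lemma lipnorm_gt0 f : Lip adj theta f -> f <> (fun=> 0) -> 0 < lipnorm adj theta f.
Proof.
move=> lf f0; have [fB _] := lip_bound_norm theta01 lf.
apply: ltr_wpDl; first exact: L1_ge0.
rewrite lt_neqAle supnorm_ge0 // andbT; apply: contra_notT f0.
rewrite negbK => /eqP s0; apply/funext => p; apply: cabs_eq0; apply/eqP.
by rewrite eq_le cabs_ge0 andbT s0 fB.
Qed.

Lemma lipnorm_iter_Tr n f : Lip adj theta f ->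
  lipnorm adj theta (iter n (Tr adj) f) <= (nbmax adj n)%:R * lipnorm adj theta f.
Proof.
move=> lf; have l0 := L1_ge0 theta01 f.
have b0 : 0 <= theta ^+ n * (nbmax adj n)%:R by rewrite mulr_ge0 ?exprn_ge0.
have fb := lip_bound_iter_Tr theta01 n l0 (lip_bound_norm theta01 lf).
apply: (le_trans (lipnorm_le _ fb)); first by rewrite mulr_ge0.
by rewrite mulrDr lerD2r ler_wpM2r // ler_piMl // exprn_ile1.
Qed.

Lemma bounded_Tr : bounded_op adj theta (Tr adj).
Proof.
split=> [f|]; first exact: (Lip_iter_Tr theta01 1).
exists (nbmax adj 1)%:R => f; exact: (lipnorm_iter_Tr 1).
Qed.

Lemma iter_Tr_one n : iter n (Tr adj) (fun=> 1 : R[i]) = fun p => (nback n (pe p 0))%:R.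
Proof.
elim: n => //= n ->; apply/funext => p; rewrite natr_sum.
by apply: eq_bigr => e ep; rewrite pe_pcons0.
Qed.

(** The constant function 1 attains the bound: its norm is at most 1, and $T^n 1$ counts backward
    paths, with maximum [nbmax adj n]. *)
Lemma opnorm_iter_Tr n : opnorm adj theta (iter n (Tr adj)) = (nbmax adj n)%:R.
Proof.
apply/eqP; rewrite eq_le; apply/andP.
have lip1 : lip_bound theta 0 1 (fun _ : npath adj => 1 : R[i]).
  by apply: (@lip_bound_liftD1 _ _ _ theta (fun=> 1)) => e; rewrite cabs1.
have Lip1 := lip_bound_Lip theta01 (lexx 0) lip1.
have one0 : (fun _ : npath adj => 1 : R[i]) <> (fun=> 0).
  have [p _] := npath_inhabited => /(congr1 (fun f => f p)) /eqP.
  by rewrite oner_eq0.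
have ubA : ubound [set lipnorm adj theta (iter n (Tr adj) f) / lipnorm adj theta f |
    f in [set f | Lip adj theta f /\ f <> (fun _ => 0)]] (nbmax adj n)%:R.
  move=> _ [f [lf f0] <-]; rewrite ler_pdivrMr ?lipnorm_gt0 //.
  exact: lipnorm_iter_Tr.
split; first by apply: ge_sup => //; eexists; exists (fun=> 1).
apply: (@le_trans _ _ (lipnorm adj theta (iter n (Tr adj) (fun=> 1)) /
                       lipnorm adj theta (fun _ : npath adj => 1 : R[i]))).
  rewrite ler_pdivlMr ?lipnorm_gt0 //.
  apply: (@le_trans _ _ (nbmax adj n)%:R).
    by rewrite ler_piMr // (le_trans (lipnorm_le _ lip1)) ?add0r.
  have [e <-] := nbmax_eq Hdeg Hne n; have [p <-] := path_from Hsym Hdeg e.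
  have lT := lip_bound_norm theta01 (Lip_iter_Tr theta01 n Lip1).
  have := le_supnorm p lT; rewrite {1}iter_Tr_one cabs_nat => /le_trans; apply.
  by rewrite lerDr L1_ge0.
by apply: ub_le_sup; [exists (nbmax adj n)%:R | exists (fun=> 1)].
Qed.

Variable lam : R[i].

Lemma TshiftZD a f g :
  Tshift adj lam (fun p => a * f p + g p) = fun p => a * Tshift adj lam f p + Tshift adj lam g p.
Proof. by apply/funext => p; rewrite /Tshift TrZD; ring. Qed.

Lemma iter_TshiftZD n a f g : iter n (Tshift adj lam) (fun p => a * f p + g p) =
  fun p => a * iter n (Tshift adj lam) f p + iter n (Tshift adj lam) g p.
Proof. by elim: n => //= n ->; rewrite TshiftZD. Qed.

Lemma Tshift0 : Tshift adj lam (fun=> 0) = fun=> 0 :> R[i].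
Proof. by apply/funext => p; rewrite /Tshift /Tr big1 // mulr0 subr0. Qed.

Lemma Tshift_liftD1 k :
  Tshift adj lam (liftD1 adj k) = liftD1 adj (fun e => Sop adj k e - lam * k e).
Proof. by rewrite /Tshift Tr_liftD1. Qed.

Lemma Lip_Tshift f : Lip adj theta f -> Lip adj theta (Tshift adj lam f).
Proof.
move=> lf; rewrite (_ : Tshift _ _ _ = fun p => - lam * f p + iter 1 (Tr adj) f p).
  exact: (LipZD theta01) _ lf (Lip_iter_Tr theta01 1 lf).
by apply/funext => p; rewrite /Tshift addrC mulNr.
Qed.

Lemma cabs_Tshift B f p : (forall q, cabs (f q) <= B) ->
  cabs (Tshift adj lam f p) <= ((nbmax adj 1)%:R + cabs lam) * B.
Proof.
move=> fB; apply: le_trans (cabsD _ _) _; rewrite cabsN cabsM mulrDl lerD //.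
  apply: le_trans (iter_Tr_sup 1 p fB) _; rewrite ler_wpM2r ?ler_nbmax //.
  exact: le_trans (cabs_ge0 _) (fB p).
by rewrite ler_wpM2l ?cabs_ge0.
Qed.

Lemma liftD1_inj k k' : liftD1 adj k = liftD1 adj k' -> k = k'.
Proof.
move=> kk'; apply/funext => e; have [p <-] := path_from Hsym Hdeg e.
exact: (congr1 (fun f => f p) kk').
Qed.

Lemma liftD1_factor f : (forall p p', pe p 0 = pe p' 0 -> f p = f p') ->
  exists k, f = liftD1 adj k.
Proof.
move=> hf; have [s hs] := choice (path_from Hsym Hdeg).
by exists (f \o s); apply/funext => p; apply: hf; rewrite hs.
Qed.

(** * Inverting $T - \lambda$ modulo $D_1$ *)

Variables M r : R.
Hypothesis lam_gt0 : 0 < cabs lam.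
Hypothesis M_ge0 : 0 <= M.
Hypothesis r01 : 0 <= r < 1.
(* [M r^n] bounds the action of [(T / lam)^n] on Lipschitz functions modulo [D_1]. *)
Hypothesis geo : forall n, theta ^+ n * (nbmax adj n)%:R <= M * (r * cabs lam) ^+ n.

Let lam_neq0 : lam != 0.
Proof. by apply: contraTneq lam_gt0 => ->; rewrite cabs0 ltxx. Qed.

Lemma iter_Tr_diff_geo A B h n p p' : 0 <= A -> lip_bound theta A B h ->
  pe p 0 = pe p' 0 ->
  cabs (iter n (Tr adj) h p - iter n (Tr adj) h p') <=
    M * (r * cabs lam) ^+ n * (A * dtheta adj theta p p').
Proof.
move=> A0 hAB pp'; have [_ /(_ _ _ pp')] := lip_bound_iter_Tr theta01 n A0 hAB.
move/le_trans; apply; rewrite -mulrA ler_wpM2r // mulr_ge0 //.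
exact: dtheta_ge0.
Qed.

(** On differences over paths with the same first edge, $T^n$ acts as multiplication by $\lambda^n$,
    yet it contracts them to order $(r|\lambda|)^n$ with $r < 1$; so they vanish. The case [k = 0]
    treats eigenfunctions, and iteration the generalized ones. *)
Lemma Tshift_D1 f k : Lip adj theta f -> Tshift adj lam f = liftD1 adj k ->
  exists k', f = liftD1 adj k'.
Proof.
move=> /(Lip_lip_bound theta01)[A A0 [B fAB]] fk; apply: liftD1_factor => p p' pp'.
have eqD q q' : pe q 0 = pe q' 0 ->
    Tr adj f q - Tr adj f q' = lam * (f q - f q').
  move=> qq'; have := congr1 (fun g => g q) fk; have := congr1 (fun g => g q') fk.
  by rewrite /Tshift /liftD1 qq' => <- /eqP; rewrite subr_eq => /eqP ->; ring.
have itD n q q' : pe q 0 = pe q' 0 ->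
    iter n (Tr adj) f q - iter n (Tr adj) f q' = lam ^+ n * (f q - f q').
  elim: n q q' => [|n IH] q q' qq'; first by rewrite mul1r.
  rewrite exprSr -mulrA -eqD // /= /Tr -qq' -!sumrB mulr_sumr.
  by apply: eq_bigr => e eq; apply: IH; rewrite !pe_pcons0 // -qq'.
apply/eqP; rewrite -subr_eq0; apply/eqP/cabs_eq0/eqP.
rewrite eq_le cabs_ge0 andbT; apply: (@geometric_small _ (M * A) r) => // n.
have := iter_Tr_diff_geo n A0 fAB pp'; rewrite itD // cabsM cabsX exprMn.
have -> : M * (r ^+ n * cabs lam ^+ n) * (A * dtheta adj theta p p') =
  cabs lam ^+ n * (M * A * r ^+ n * dtheta adj theta p p') by ring.
rewrite ler_pM2l ?exprn_gt0 // => /le_trans; apply.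
rewrite ler_piMr ?dtheta_le1 // !mulr_ge0 // exprn_ge0 //.
by case/andP: r01.
Qed.

Lemma eigspaceT_D1 f : eigspaceT adj theta lam f <->
  exists k, Eq (Sop adj) (fun x e => lam * x e) k /\ f = liftD1 adj k.
Proof.
split=> [[lf Tf]|[k [Sk ->]]]; last first.
  by split; [exact: Lip_liftD1 | rewrite Tr_liftD1 Sk].
have [|k fk] := @Tshift_D1 f (fun=> 0) lf.
  by apply/funext => p; rewrite /Tshift Tf subrr.
by exists k; split=> //; apply: liftD1_inj; rewrite -Tr_liftD1 -fk Tf fk.
Qed.

Lemma geneigspaceT_D1 f : geneigspaceT adj theta lam f -> exists k, f = liftD1 adj k.
Proof.
case=> lf [n]; elim: n f lf => [|n IH] f lf; first by move=> /= ->; exists (fun=> 0).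
rewrite iterSr => /(IH _ (Lip_Tshift lf))[k fk].
exact: Tshift_D1 fk.
Qed.

Lemma geneigspaceT_findim : findim adj (geneigspaceT adj theta lam).
Proof.
have [||n [b hb]] := @subspace_spanning_family _ _
  (fun k : E adj -> R[i] => geneigspaceT adj theta lam (liftD1 adj k)).
- by split; [exact: Lip_liftD1 | exists 0%N].
- move=> a g h [lg [m gm]] [lh [n hn]]; split; first exact: Lip_liftD1.
  have it0 j : iter j (Tshift adj lam) (fun=> 0) = fun=> 0 :> R[i].
    by elim: j => //= j ->; rewrite Tshift0.
  (* Powers of [Tshift] commute, so the exponent [m + n] annihilates both summands. *)
  exists (m + n)%N; rewrite (_ : liftD1 _ _ = fun p => a * liftD1 adj g p + liftD1 adj h p) //.
  have g0 : iter (m + n) (Tshift adj lam) (liftD1 adj g) = fun=> 0.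
    by rewrite addnC iterD gm it0.
  have h0 : iter (m + n) (Tshift adj lam) (liftD1 adj h) = fun=> 0.
    by rewrite iterD hn it0.
  by rewrite iter_TshiftZD g0 h0; apply/funext => p; rewrite mulr0 addr0.
exists n, (fun i => liftD1 adj (b i)) => f; split=> [fS|[c ->]].
  have [k fk] := geneigspaceT_D1 fS; rewrite fk in fS *.
  by have /hb[c ->] := fS; exists c.
by apply/(hb (fun e => \sum_(i < n) c i * b i e)); exists c.
Qed.

(* [neumann n h] is minus the [n]th partial sum of the Neumann series of
   [(lam - T)^-1 h]; it converges modulo [D_1]. *)
Fixpoint neumann n h : npath adj -> R[i] :=
  if n is m.+1 then fun p => - (lam ^- m.+1) * iter m (Tr adj) h p + neumann m h p
  else fun=> 0.

(** The series telescopes, leaving only the last remainder. *)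
Lemma Tshift_neumann n h :
  Tshift adj lam (neumann n h) = fun p => h p - lam ^- n * iter n (Tr adj) h p.
Proof.
elim: n => [|n IH].
  by rewrite Tshift0; apply/funext => p; rewrite expr0 invr1 mul1r subrr.
rewrite /= TshiftZD IH; apply/funext => p; rewrite /Tshift exprS.
by field; rewrite lam_neq0 expf_neq0.
Qed.

(** [D * r ^+ n] bounds the effect of the [n]th Neumann term on differences, and [K] is the sum of
    these bounds. *)
Let D := M / cabs lam.
Let K := D / (1 - r).
Let r_ge0 : 0 <= r. Proof. by case/andP: r01. Qed.
Let r_lt1 : 0 < 1 - r. Proof. by case/andP: r01; rewrite subr_gt0. Qed.
Let D_ge0 : 0 <= D. Proof. by rewrite divr_ge0 ?cabs_ge0. Qed.
Let K_ge0 : 0 <= K. Proof. by rewrite divr_ge0 // ltW. Qed.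

Section NeumannLimit.
Variables (A B : R) (h : npath adj -> R[i]).
Hypothesis A_ge0 : 0 <= A.
Hypothesis hAB : lip_bound theta A B h.

Let term_diff n p p' : pe p 0 = pe p' 0 ->
  cabs (lam ^- n.+1 * (iter n (Tr adj) h p - iter n (Tr adj) h p')) <=
    D * r ^+ n * (A * dtheta adj theta p p').
Proof.
move=> pp'; rewrite cabsM cabsV cabsX mulrC ler_pdivrMr ?exprn_gt0 //.
apply: le_trans (iter_Tr_diff_geo n A_ge0 hAB pp') _.
rewrite le_eqVlt; apply/orP; left; apply/eqP; rewrite /D exprMn exprS.
by field; rewrite gt_eqF.
Qed.

Let neumann_diff n p p' : pe p 0 = pe p' 0 ->
  cabs (neumann n h p - neumann n h p') <=
    K * (1 - r ^+ n) * (A * dtheta adj theta p p').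
Proof.
move=> pp'; elim: n => [|n IH]; first by rewrite subrr cabs0 expr0 subrr mulr0 mul0r.
rewrite /= opprD addrACA -mulrBr mulNr.
apply: le_trans (cabsD _ _) _; rewrite cabsN.
apply: le_trans (lerD (term_diff n pp') IH) _.
rewrite le_eqVlt; apply/orP; left; apply/eqP; rewrite /K exprS.
by field; rewrite gt_eqF.
Qed.

(** [f0] is the limit of the partial sums normalised to vanish on the chosen paths [s e]. The
    normalisation changes them by elements of $D_1$, so $(T - \lambda) f_0 = h$ is recovered only up
    to a function of the first edge. *)
Lemma neumann_limit : exists f0, [/\ forall p, cabs (f0 p) <= 2 * K * A,
  forall p p', pe p 0 = pe p' 0 -> cabs (f0 p - f0 p') <= K * A * dtheta adj theta p p' &
  forall p p', pe p 0 = pe p' 0 ->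
    Tshift adj lam f0 p - h p = Tshift adj lam f0 p' - h p'].
Proof.
have [s hs] := choice (path_from Hsym Hdeg).
pose z p n := neumann n h p - neumann n h (s (pe p 0)).
have lim_z p : exists l, forall n, cabs (l - z p n) <= 2 * K * A * r ^+ n.
  have [|//|n|l hl] := @geometric_cauchy _ (z p) (D * A) r.
  - by rewrite mulr_ge0.
  - have -> : z p n.+1 - z p n =
       - (lam ^- n.+1 * (iter n (Tr adj) h p - iter n (Tr adj) h (s (pe p 0)))).
      by rewrite /z /=; ring.
    have ps : pe p 0 = pe (s (pe p 0)) 0 by rewrite hs.
    rewrite cabsN; apply: le_trans (term_diff n ps) _.
    by rewrite mulrA [leRHS]mulrAC ler_piMr ?dtheta_le1 // (mulr_ge0 (mulr_ge0 D_ge0 (exprn_ge0 _ r_ge0))).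
  exists l => n; apply: (le_trans (hl n)); rewrite le_eqVlt; apply/orP; left; apply/eqP.
  by rewrite /K; ring.
have [f0 hf0] := choice lim_z.
have K2A : 0 <= 2 * K * A by rewrite -mulrA mulr_ge0 // (mulr_ge0 K_ge0).
exists f0; split=> [p|p p' pp'|p p' pp'].
- by have := hf0 p 0%N; rewrite /z subrr subr0 mulr1.
- rewrite -subr_le0; apply: (@geometric_small _ (2 * (2 * K * A)) r) => // n.
  have zd : z p n - z p' n = neumann n h p - neumann n h p'.
    by rewrite /z pp'; ring.
  have Kd := neumann_diff n pp'; rewrite -zd in Kd.
  have := cabs_dist (f0 p) (z p n) (f0 p').
  have := cabs_dist (z p n) (z p' n) (f0 p'); rewrite [cabs (z p' n - _)]cabsB.
  have := hf0 p n; have := hf0 p' n.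
  have : K * (1 - r ^+ n) * (A * dtheta adj theta p p') <= K * A * dtheta adj theta p p'.
    rewrite mulrA ler_wpM2r ?dtheta_ge0 // mulrAC ler_piMr ?(mulr_ge0 K_ge0) //.
    by rewrite lerBlDr lerDl exprn_ge0.
  lra.
apply/eqP; rewrite -subr_eq0; apply/eqP/cabs_eq0/eqP.
rewrite eq_le cabs_ge0 andbT.
pose a := (nbmax adj 1)%:R + cabs lam.
apply: (@geometric_small _ (2 * (a * (2 * K * A)) + M * A) r) => // n.
(* This is [f0 q - z q n], written as a linear combination to let [TshiftZD] apply. It is uniformly
   small, hence so is its image, and the [liftD1] part cancels between [p] and [p']. *)
pose v q := -1 * neumann n h q + (1 * f0 q + liftD1 adj (fun e => neumann n h (s e)) q).
have vB q : cabs (v q) <= 2 * K * A * r ^+ n.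
  by rewrite (_ : v q = f0 q - z q n) // /v /z /liftD1; ring.
have Tv q : Tshift adj lam v q = lam ^- n * iter n (Tr adj) h q +
   (Tshift adj lam f0 q - h q) + Tshift adj lam (liftD1 adj (fun e => neumann n h (s e))) q.
  by rewrite /v TshiftZD TshiftZD Tshift_neumann; ring.
have := @cabs_Tshift _ v p vB; have := @cabs_Tshift _ v p' vB.
have itd : cabs (lam ^- n * (iter n (Tr adj) h p - iter n (Tr adj) h p')) <= M * A * r ^+ n.
  rewrite cabsM cabsV cabsX mulrC ler_pdivrMr ?exprn_gt0 //.
  apply: le_trans (iter_Tr_diff_geo n A_ge0 hAB pp') _.
  rewrite exprMn mulrA [leRHS](_ : _ = M * (r ^+ n * cabs lam ^+ n) * A); last by ring.
  rewrite ler_piMr ?dtheta_le1 // !mulr_ge0 ?exprn_ge0 ?cabs_ge0 //.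
have := cabsD (Tshift adj lam v p - Tshift adj lam v p')
   (- (lam ^- n * (iter n (Tr adj) h p - iter n (Tr adj) h p'))).
have := cabsD (Tshift adj lam v p) (- Tshift adj lam v p').
rewrite !cabsN.
have -> : Tshift adj lam v p - Tshift adj lam v p' -
    lam ^- n * (iter n (Tr adj) h p - iter n (Tr adj) h p') =
  Tshift adj lam f0 p - h p - (Tshift adj lam f0 p' - h p').
  by rewrite !Tv Tshift_liftD1 /liftD1 pp'; ring.
rewrite -/a; lra.
Qed.

End NeumannLimit.

(** * From the inverse of $S - \lambda$ to a bounded resolvent *)

Lemma Sop_alternative :
  (exists2 k, k <> (fun=> 0) & Sop adj k = fun e => lam * k e) \/
  (exists L : E adj -> E adj -> R[i], forall k e,
     Sop adj (fun e1 => \sum_e2 L e1 e2 * k e2) e -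
     lam * (\sum_e2 L e e2 * k e2) = k e).
Proof.
pose N (e e' : E adj) : R[i] := (turn e' e)%:R - lam * (e == e')%:R.
have NE k e : \sum_e' N e e' * k e' = Sop adj k e - lam * k e.
  transitivity (\sum_(e' : E adj) ((if turn e' e then k e' else 0) -
      lam * (if e' == e then k e' else 0))).
    apply: eq_bigr => e' _; rewrite /N eq_sym.
    by case: (turn e' e); case: (e' == e) => /=; ring.
  by rewrite sumrB -mulr_sumr -!big_mkcond /= big_pred1_eq.
have [[k k0 Nk]|[L NL]] := finite_alternative N; [left|right].
  exists k => //; apply/funext => e; apply/eqP; rewrite -subr_eq0.
  by rewrite -NE Nk.
by exists L => k e; rewrite -NE NL.
Qed.

Lemma Tshift_surjective (L : E adj -> E adj -> R[i]) :
    (forall k e, Sop adj (fun e1 => \sum_e2 L e1 e2 * k e2) e -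
       lam * (\sum_e2 L e e2 * k e2) = k e) ->
  exists Q, forall h, Lip adj theta h -> exists f,
    [/\ Lip adj theta f, Tshift adj lam f = h & lipnorm adj theta f <= Q * lipnorm adj theta h].
Proof.
move=> SL; pose a := (nbmax adj 1)%:R + cabs lam; pose b := \sum_e \sum_e' cabs (L e e').
have a_ge0 : 0 <= a by rewrite addr_ge0 ?cabs_ge0.
have b_ge0 : 0 <= b by rewrite sumr_ge0 // => e _; rewrite sumr_ge0 // => e' _; apply: cabs_ge0.
(* [f0] costs [K * A] in seminorm and [2 * K * A] in sup norm. The defect [k] is at most
   [a * (2 * K * A) + B], and inverting $S - \lambda$ multiplies this by at most [b]. *)
exists (3 * K + b * (2 * K * a + 1)) => h lh.
rewrite /(lipnorm adj theta h); have := lip_bound_norm theta01 lh.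
have := L1_ge0 theta01 h; have := supnorm_ge0 lh.
move: (L1 adj theta h) (supnorm adj h) => A B B0 A0 hAB.
have [f0 [f0B f0A f0T]] := neumann_limit A0 hAB.
have [k kE] := @liftD1_factor (fun p => Tshift adj lam f0 p - h p) f0T.
have kB e : cabs (k e) <= a * (2 * K * A) + B.
  have [p <-] := path_from Hsym Hdeg e; rewrite -[k _](congr1 (fun f => f p) kE).
  apply: le_trans (cabsD _ _) _; rewrite cabsN lerD //; first exact: cabs_Tshift.
  by case: hAB.
pose j e := \sum_e' L e e' * k e'.
have jB e : cabs (j e) <= b * (a * (2 * K * A) + B).
  apply: le_trans (cabs_sum _ _) _.
  apply: (@le_trans _ _ (\sum_e' cabs (L e e') * (a * (2 * K * A) + B))).
    by apply: ler_sum => e' _; rewrite cabsM ler_wpM2l ?cabs_ge0.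
  rewrite -mulr_suml ler_wpM2r ?(le_trans (cabs_ge0 _) (kB e)) //.
  rewrite /b [leRHS](bigD1 e) //= lerDl sumr_ge0 // => e1 _.
  by rewrite sumr_ge0 // => e2 _; apply: cabs_ge0.
have f0b : lip_bound theta (K * A) (2 * K * A) f0 by [].
have fb := lip_boundZD (-1) (lip_bound_liftD1 theta jB) f0b.
rewrite cabsN cabs1 !mul1r add0r in fb.
have KA0 : 0 <= K * A by rewrite (mulr_ge0 K_ge0).
exists (fun p => -1 * liftD1 adj j p + f0 p); split.
- exact: lip_bound_Lip fb.
- rewrite TshiftZD Tshift_liftD1; apply/funext => p; rewrite /liftD1 SL.
  by have := congr1 (fun f => f p) kE; rewrite /liftD1 => <-; ring.
apply: (le_trans (lipnorm_le KA0 fb)).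
have KB0 : 0 <= K * B by rewrite (mulr_ge0 K_ge0).
have := mulr_ge0 b_ge0 A0; have := mulr_ge0 b_ge0 (mulr_ge0 a_ge0 KB0).
by lra.
Qed.

(** Bounded solutions exist by [Tshift_surjective]; injectivity, since the kernel lies in $D_1$ and
    would consist of eigenfunctions of $S$, makes the chosen solution a left inverse too. *)
Lemma resolvent_of_Sop :
  ~ (exists2 k, k <> (fun=> 0) & Sop adj k = fun e => lam * k e) ->
  in_resolvent adj theta lam.
Proof.
move=> noeig; case: Sop_alternative => [//|[L /Tshift_surjective[Q hQ]]].
have inj f f' : Lip adj theta f -> Lip adj theta f' ->
    Tshift adj lam f = Tshift adj lam f' -> f = f'.
  move=> lf lf' ff'; pose g p := -1 * f' p + f p.
  have [|k [Sk gk]] := (eigspaceT_D1 g).1.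
    split; first exact: LipZD.
    have := TshiftZD (-1) f' f; rewrite -/g ff' => Tg.
    apply/funext => p; apply/eqP; rewrite -subr_eq0; apply/eqP.
    by rewrite -[LHS]/(Tshift adj lam g p) Tg mulN1r addNr.
  have k0 : k = fun=> 0 by apply: contrapT => k0; apply: noeig; exists k.
  apply/funext => p; have := congr1 (fun f => f p) gk; rewrite /g k0 /liftD1 mulN1r.
  by move/eqP; rewrite addrC subr_eq0 => /eqP.
have sol h : exists f, Lip adj theta h ->
    [/\ Lip adj theta f, Tshift adj lam f = h &
        lipnorm adj theta f <= Q * lipnorm adj theta h].
  have [lh|nlh] := pselect (Lip adj theta h); last by exists (fun=> 0).
  by have [f hf] := hQ h lh; exists f.
have [S hS] := choice sol; exists S; split; last split.
- by split=> [h /hS[]//|]; exists Q => h /hS[].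
- move=> f lf; have [lS TS _] := hS _ (Lip_Tshift lf).
  exact: inj.
- by move=> h /hS[].
Qed.

Lemma spectrum_finite_mult : in_spectrum adj theta lam ->
  finite_mult_eigenvalue adj theta lam.
Proof.
move=> spec; split; last exact: geneigspaceT_findim.
have [[k k0 Sk]|nok] := pselect
    (exists2 k : E adj -> R[i], k <> (fun=> 0) & Sop adj k = fun e => lam * k e); last first.
  by case: spec; apply: resolvent_of_Sop.
exists (liftD1 adj k); split; first by apply/eigspaceT_D1; exists k.
by move=> kk; apply: k0; apply: liftD1_inj; rewrite kk.
Qed.

End Spectrum.

(** * Eigenfunctions of $S$ and functions on vertices *)

Section VertexEigenfunctions.
Variables (R : realType) (V : finType) (adj : rel V).
Hypothesis Hsym : symmetric adj.
Hypothesis Hdeg : forall v, (2 <= deg adj v)%N.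
Variable lam : R[i].
Hypothesis lam_neq0 : lam != 0.
Implicit Types (f : V -> R[i]) (g : E adj -> R[i]) (v w : V) (e : E adj).

Lemma Eq_Sigma_Delta : Eq (Sigma adj) (Rlam adj lam) = Eq (Delta adj) (Llam adj lam).
Proof.
have q0 v : 1 + (qv adj v)%:R != 0 :> R[i] by rewrite nat1r pnatr_eq0.
apply/seteqP; split=> f /= fE; apply/funext => v.
  have := congr1 (fun h => h v) fE; rewrite /Sigma /Rlam /Delta /Llam => ->.
  by field; rewrite lam_neq0 q0.
have := congr1 (fun h => h v) fE; rewrite /Sigma /Rlam /Delta /Llam => fv.
apply: (mulfI (invr_neq0 (q0 v))); rewrite fv.
by field; rewrite lam_neq0 q0.
Qed.

(** The origins of the predecessors of [e] are all neighbours of [ini e] except [ter e], so the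
    vertex sum appears with one term removed. *)
Lemma Sop_dlam f e : Sop adj (dlam adj lam f) e =
  Sigma adj f (ini e) - f (ter e) - lam^-1 * (qv adj (ini e))%:R * f (ini e).
Proof.
rewrite /Sop (sum_turn Hsym (fun v w => f v - lam^-1 * f w)) sumrB.
rewrite /Sigma [in RHS](bigD1 (ter e)) ?adj_edge //= [_ + _ - f _]addrC addKr; congr (_ - _).
rewrite sumr_const -(card_adj_neq (adj_edge e)) mulrAC mulr_natr.
by congr (_ *+ _); apply: eq_card => v; rewrite !inE.
Qed.

Lemma dlam_eigenvector f : Eq (Sigma adj) (Rlam adj lam) f ->
  Eq (Sop adj) (fun h e => lam * h e) (dlam adj lam f).
Proof.
move=> fE; apply/funext => e; rewrite Sop_dlam fE /Rlam /dlam.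
by field.
Qed.

Hypothesis lam_neq1 : lam <> 1.
Hypothesis lam_neqN1 : lam <> -1.

Let lam2 : lam ^+ 2 - 1 != 0.
Proof.
rewrite subr_eq0 sqrf_eq1 negb_or.
by apply/andP; split; apply/eqP.
Qed.

(** An edge and its reverse give a 2 by 2 system for the values at its ends, with determinant $1 -
    \lambda^{-2}$. *)
Lemma dlam_inj f1 f2 : dlam adj lam f1 = dlam adj lam f2 -> f1 = f2.
Proof.
move=> eqd; apply/funext => v; have [e ev] := edge_from Hdeg v.
have h1 : f1 v - lam^-1 * f1 (ter e) = f2 v - lam^-1 * f2 (ter e).
  by rewrite -ev; exact: (congr1 (fun h => h e) eqd).
have h2 : f1 (ter e) - lam^-1 * f1 v = f2 (ter e) - lam^-1 * f2 v.
  by rewrite -ev; exact: (congr1 (fun h => h (edge_rev Hsym e)) eqd).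
apply/eqP; rewrite -subr_eq0 -(mulrI_eq0 _ (lregP lam2)); apply/eqP.
have -> : (lam ^+ 2 - 1) * (f1 v - f2 v) =
  lam ^+ 2 * ((f1 v - lam^-1 * f1 (ter e)) - (f2 v - lam^-1 * f2 (ter e))) +
  lam * ((f1 (ter e) - lam^-1 * f1 v) - (f2 (ter e) - lam^-1 * f2 v)) by field.
by rewrite h1 h2 !subrr !mulr0 addr0.
Qed.

(* Both [g] and [g \o edge_rev] determine [f]: from the two equations of an edge,
   [(lam - lam^-1) * f v = lam * g (v, w) + g (w, v)], and by [S g = lam g] the
   right-hand side is the sum of [g] over all edges ending at [v]. *)
Lemma dlam_surj g : Eq (Sop adj) (fun h e => lam * h e) g ->
  exists f, Eq (Sigma adj) (Rlam adj lam) f /\ dlam adj lam f = g.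
Proof.
move=> gE; pose f v := (\sum_(e | ter e == v) g e) / (lam - lam^-1).
have ll : lam - lam^-1 != 0.
  rewrite -(mulrI_eq0 _ (lregP lam_neq0)) mulrBr divff // -expr2; exact: lam2.
have fE e : f (ini e) = (lam * g e + g (edge_rev Hsym e)) / (lam - lam^-1).
  rewrite /f -[lam * g e](congr1 (fun h => h e) gE) (bigD1 (edge_rev Hsym e)) //= addrC.
  congr ((_ + _) / _); apply: eq_bigl => e'; rewrite /turn; apply: andb_id2l => /eqP te.
  apply/idP/idP; apply: contra => /eqP et; last by rewrite et.
  by apply/eqP/edge_eq.
have dE : dlam adj lam f = g.
  apply/funext => e; rewrite /dlam -[ter e]/(ini (edge_rev Hsym e)) !fE edge_revK.
  by field; rewrite lam_neq0 -expr2 lam2.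
(* With [dlam adj lam f = g] known, [Sop_dlam] at any edge leaving [v] can be solved for
   [Sigma adj f v]. *)
exists f; split=> //; apply/funext => v; have [e ev] := edge_from Hdeg v.
have := congr1 (fun h => h e) gE; rewrite -{1}dE Sop_dlam -[in RHS]dE /dlam ev /Rlam.
move/eqP; rewrite subr_eq => /eqP; move/eqP; rewrite subr_eq => /eqP ->.
by field.
Qed.

End VertexEigenfunctions.

Theorem mainTheorem10 (R : realType) (V : finType) (adj : rel V)
  (Hne : (0 < #|V|)%N)
  (Hsym : symmetric adj) (Hirr : irreflexive adj)
  (Hconn : forall x y : V, connect adj x y)
  (Hdeg : forall v : V, (2 <= deg adj v)%N) :
  (forall theta : R, 0 < theta < 1 -> bounded_op adj theta (Tr adj)) /\
  exists rho : R,
    (forall theta : R, 0 < theta < 1 ->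
       (fun n : nat => opnorm adj theta (iter n (Tr adj)) `^ (n%:R^-1)) @ \oo --> rho) /\
    rho <= (qmax adj)%:R /\
    (rho = (qmax adj)%:R <-> regular adj) /\
    forall (theta : R), 0 < theta < 1 ->
    forall lam : R[i], in_spectrum adj theta lam -> theta * rho < cabs lam ->
      finite_mult_eigenvalue adj theta lam /\
      (forall f : npath adj -> R[i],
         eigspaceT adj theta lam f <->
         exists g : E adj -> R[i],
           Eq (Sop adj) (fun h e => lam * h e) g /\ f = liftD1 adj g) /\
      (lam <> 1 -> lam <> -1 ->
         Eq (Sigma adj) (Rlam adj lam) = Eq (Delta adj) (Llam adj lam) /\
         (forall f : V -> R[i], Eq (Sigma adj) (Rlam adj lam) f ->
            Eq (Sop adj) (fun h e => lam * h e) (dlam adj lam f)) /\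
         (forall f1 f2 : V -> R[i],
            Eq (Sigma adj) (Rlam adj lam) f1 ->
            Eq (Sigma adj) (Rlam adj lam) f2 ->
            dlam adj lam f1 = dlam adj lam f2 -> f1 = f2) /\
         (forall g : E adj -> R[i], Eq (Sop adj) (fun h e => lam * h e) g ->
            exists f : V -> R[i], Eq (Sigma adj) (Rlam adj lam) f /\ dlam adj lam f = g)).
Proof.
split=> [theta t01|]; first exact: bounded_Tr.
(* The sequence [nbmax] does not involve [theta], hence neither does [rho]. *)
have [n|m n|rho rho0 [rho_lim rho_le rho_geo]] :=
    @submultiplicative_root R (fun n => (nbmax adj n)%:R).
- by rewrite ler1n nbmax_gt0.
- by rewrite -natrM ler_nat nbmax_submul.
exists rho; split; last split; last split.
- move=> theta t01; rewrite (_ : (fun n => _) = fun n : nat => (nbmax adj n)%:R `^ n%:R^-1) //.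
  by apply/funext => n; rewrite opnorm_iter_Tr.
- by have := rho_le 1%N; rewrite nbmax1.
- split=> [rhoq|reg].
    apply: nbmax_eq_regular => // n; apply/eqP; rewrite eqn_leq nbmax_le //=.
    by have := rho_le n; rewrite rhoq -natrX ler_nat.
  apply/eqP; rewrite eq_le; apply/andP; split.
    by have := rho_le 1%N; rewrite nbmax1.
  rewrite leNgt; apply/negP => lt.
  have q0 : 0 < (qmax adj)%:R :> R by rewrite ltr0n qmax_gt0.
  (* If [rho] were smaller, this midpoint would give $q^n \le M c^n$ with $c < q$ for all $n$. *)
  pose c := (rho + (qmax adj)%:R) / 2.
  have c0 : 0 < c by rewrite /c; lra.
  have [M hM] : exists M, forall n, (nbmax adj n)%:R <= M * c ^+ n.
    by apply: rho_geo; rewrite /c; lra.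
  have : (1 : R) <= 0.
    apply: (@geometric_small _ M (c / (qmax adj)%:R)) => [|n].
      apply/andP; split; first exact: divr_ge0 (ltW c0) (ltW q0).
      by rewrite ltr_pdivrMr // mul1r /c; lra.
    rewrite expr_div_n mulrA ler_pdivlMr ?exprn_gt0 // mul1r -natrX.
    by rewrite -nbmax_regular.
  by rewrite ler10.
move=> theta t01 lam spec lam_rho.
have t0 : 0 < theta by case/andP: t01.
have lam0 : 0 < cabs lam by apply: le_lt_trans lam_rho; rewrite mulr_ge0 // ltW.
(* A rate strictly between [rho] and [cabs lam / theta]: being above [rho] it bounds [nbmax], being
   below the other it makes the ratio [r] less than 1. *)
pose c := (rho + cabs lam / theta) / 2.
have rho_lt : rho < cabs lam / theta by rewrite ltr_pdivlMr // mulrC.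
have c0 : 0 <= c by rewrite /c; lra.
have [M0 hM0] : exists M, forall n, (nbmax adj n)%:R <= M * c ^+ n.
  by apply: rho_geo; rewrite /c; lra.
have M_ge0 : 0 <= M0.
  by have := hM0 0%N; rewrite mulr1; apply: le_trans.
pose r := theta * c / cabs lam.
have r01 : 0 <= r < 1.
  apply/andP; split; first exact: divr_ge0 (mulr_ge0 (ltW t0) c0) (ltW lam0).
  rewrite ltr_pdivrMr // mul1r mulrC -ltr_pdivlMr //.
  by rewrite /c; lra.
have geo n : theta ^+ n * (nbmax adj n)%:R <= M0 * (r * cabs lam) ^+ n.
  by rewrite /r divfK ?gt_eqF // exprMn mulrCA ler_wpM2l ?exprn_ge0 // ltW.
have lam_neq0 : lam != 0 by apply: contraTneq lam0 => ->; rewrite cabs0 ltxx.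
split; first exact: spectrum_finite_mult geo spec.
split=> [f|lam1 lamN1]; first exact: eigspaceT_D1 geo f.
split; first exact: Eq_Sigma_Delta.
split; first by move=> f; apply: dlam_eigenvector.
split; first by move=> f1 f2 _ _; apply: dlam_inj.
by move=> g; apply: dlam_surj.
Qed.
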